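(* Let $\alpha,\beta,\gamma$ be defined so that $e_{\min}=\alpha\binom n2$, $M=\beta n$, and $m=\gamma M$, where $e_{\min}=e_{\min}(M,m,n)$ is the minimum edge count needed to guarantee an agreement of $M$ with fixed $m$ and $n$. In the limit as $n\to\infty$, $$\alpha=\begin{cases}\beta\left(2-(1-\gamma)^2\beta\right) & \text{if } 0\le\beta\le\frac12,\\[2pt] \beta(\gamma+1)\left(2-\beta(\gamma+1)\right) & \text{if } \frac12<\beta\le\frac{1}{1+\gamma}.\end{cases}$$
   Context: A circular arc is a connected arc $[x,y]$ on a fixed circle, traversed clockwise from its left endpoint $x$ to its right endpoint $y$. All $2n$ endpoints of a collection of $n$ arcs are assumed pairwise distinct. For a point $p$ on the circle, the agreement number $a(p)$ is the number of arcs of the collection containing $p$; the maximum and minimum agreement numbers of the collection are $\max_p a(p)$ and $\min_p a(p)$. The number of edges of a collection is the number of edges of its intersection graph, i.e. the number of unordered pairs of its arcs that intersect. For $M+m\le n+1$, the minimum edge count $e_{\min}(M,m,n)$ needed to guarantee an agreement of $M$ with fixed $m$ and $n$ is the minimum number $e$ such that every collection of $n$ arcs with minimum agreement number $m$ and at least $e$ edges has maximum agreement number at least $M$. Thus $\alpha$ is the fraction of all possible edges, $\beta$ is the agreement proportion, and $\gamma$ is the ratio of minimum to maximum agreement.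
   Formalization: The limit is proved for 0 ≤ γ ≤ 1; when γ = 1 and β > 0 it is also assumed that m + 1 < M for all large n, since if M ≤ m + 1 distinct endpoints force agreement at least m + 1, so e_min = 0 while the formula gives 2β. *)

(* Defs.v *)
From HB Require Import structures.
From mathcomp Require Import all_boot all_order all_algebra.
From mathcomp Require Import all_classical all_reals all_analysis.

Set Implicit Arguments.
Unset Strict Implicit.
Unset Printing Implicit Defensive.

Import Order.TTheory GRing.Theory Num.Theory.
Import numFieldNormedType.Exports.

Local Open Scope classical_set_scope.
Local Open Scope ring_scope.

(* A point of the circle is given by its clockwise distance from a fixed base
   point, the circumference being 1. *)
Definition circle (R : realType) := {p : R | 0 <= p < 1}.

Definition circle_base (R : realType) : circle R :=
  exist _ 0 (introT andP (conj (lexx 0) ltr01)).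

(* The closed arc [x, y], traversed clockwise from x to y; when y precedes x in
   [0, 1), it goes through the base point. *)
Definition in_arc (R : realType) (x y p : circle R) : bool :=
  if val x <= val y then val x <= val p <= val y
  else (val x <= val p) || (val p <= val y).

Definition arc (R : realType) (x y : circle R) : set (circle R) :=
  [set p | in_arc x y p].

Record arcs (R : realType) (n : nat) := Arcs {
  left_end : 'I_n -> circle R;
  right_end : 'I_n -> circle R;
  left_end_inj : injective left_end;
  right_end_inj : injective right_end;
  left_right_neq : forall i j, left_end i <> right_end j }.

Section Agreement.
Variables (R : realType) (n : nat).
Implicit Type A : arcs R n.

Definition arc_of A (i : 'I_n) : set (circle R) :=
  arc (left_end A i) (right_end A i).

Definition agreement A (p : circle R) : nat :=
  #|[set i | in_arc (left_end A i) (right_end A i) p]%SET|.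

Lemma agreement_ex A : exists k, `[< exists p, agreement A p = k >].
Proof.
by exists (agreement A (circle_base R)); apply/asboolP; exists (circle_base R).
Qed.

Lemma agreement_ub A k : `[< exists p, agreement A p = k >] -> (k <= n)%N.
Proof. by move=> /asboolP[p <-]; rewrite -[leqRHS]card_ord max_card. Qed.

Definition max_agreement A : nat := ex_maxn (agreement_ex A) (@agreement_ub A).

Definition min_agreement A : nat := ex_minn (agreement_ex A).

(* An unordered pair of distinct arcs is represented by its indices i < j. *)
Definition edges A : nat :=
  #|[set ij : 'I_n * 'I_n | (ij.1 < ij.2)%N &&
       `[< arc_of A ij.1 `&` arc_of A ij.2 !=set0 >]]%SET|.

Definition guarantees (M m e : nat) : Prop :=
  forall A, min_agreement A = m -> (e <= edges A)%N ->
    (M <= max_agreement A)%N.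

Lemma guarantees_ex M m : exists e, `[< guarantees M m e >].
Proof.
exists #|{: 'I_n * 'I_n}|.+1; apply/asboolP => A _ eA.
by have := leq_trans eA (max_card _); rewrite ltnn.
Qed.

End Agreement.

(* Since endpoints are distinct, the agreement number of a nonempty collection
   is never constant, so that e_min R M m n = 0 as soon as n > 0 and
   M <= m + 1. *)
Definition e_min (R : realType) (M m n : nat) : nat :=
  ex_minn (@guarantees_ex R n M m).

(* Main.v *)
Require Import Defs.
From HB Require Import structures.
From mathcomp Require Import all_boot all_order all_algebra.
From mathcomp Require Import all_classical all_reals all_analysis.
From mathcomp Require Import lra ring zify.

(* Two arcs meet iff one of them contains the left end of the other, so the
   number of edges is the sum over the left ends l_j of a(l_j) - 1, minus the
   number of pairs of arcs containing each other's left end.  Clockwise from a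
   point q of minimum agreement m, the r-th left end (r = 0, 1, ...) has agreement
   at most min(M - 1, m + r + 1), which yields Mn - (M - m)^2 / 2 edges up to O(n).
   Listing instead the m arcs through q first and the others by left end, the r-th
   arc meets at most min(r, M + m - 2) of its predecessors, which yields
   (M + m)n - (M + m)^2 / 2 up to O(n).  Conversely, with left ends 0, ..., n - 1
   and right ends d + 1/2, ..., d + n - 1/2, where d = M - 2 - m, the k-th left end
   being paired with the right end of rank k + m modulo n, all agreements lie
   between m and M - 1 and only m max(0, 2M - n) + O(n) pairs contain each other's
   left end: the two upper bounds are attained for M <= n/2 and M >= n/2. *)

Set Implicit Arguments.
Unset Strict Implicit.
Unset Printing Implicit Defensive.

Import Order.TTheory GRing.Theory Num.Theory.
Import numFieldNormedType.Exports.

Local Open Scope classical_set_scope.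
Local Open Scope ring_scope.

(** * Counting indices, pairs and ranks *)

Lemma sum_nat_card (T : finType) (P : pred T) :
  (\sum_(x : T) P x = #|[set x | P x]%SET|)%N.
Proof.
rewrite -sum1_card [RHS]big_mkcond /=; apply: eq_bigr => x _.
by rewrite inE; case: (P x).
Qed.

Lemma sum_ltn_ord n c : (\sum_(k < n) (k < c) = minn c n)%N.
Proof.
elim: n => [|n IHn]; first by rewrite big_ord0 minn0.
by rewrite big_ord_recr /= IHn; case: (ltnP n c) => /= h; lia.
Qed.

Lemma sum_itv_ord n a b : (\sum_(k < n) (a <= k < b) <= b - a)%N.
Proof.
have : (\sum_(k < n) (a <= k < b) + \sum_(k < n) (k < minn a b) =
        \sum_(k < n) (k < b))%N.
  by rewrite -big_split /=; apply: eq_bigr => k _; lia.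
by rewrite !sum_ltn_ord; lia.
Qed.

(** Inclusion-exclusion: on both sides an unordered pair is counted once for each of its two
    orderings that satisfies [P]. *)
Lemma card_sym_pairs n (P : rel 'I_n) :
  (#|[set ij : 'I_n * 'I_n | (ij.1 < ij.2)%N && (P ij.1 ij.2 || P ij.2 ij.1)]%SET|
   + #|[set ij : 'I_n * 'I_n | (ij.1 < ij.2)%N && (P ij.1 ij.2 && P ij.2 ij.1)]%SET|
   = \sum_(j < n) #|[set i | (i != j) && P i j]%SET|)%N.
Proof.
under [RHS]eq_bigr do rewrite -sum_nat_card.
rewrite exchange_big pair_big /= -!sum_nat_card -big_split /=.
transitivity (\sum_(ij : 'I_n * 'I_n) ((ij.1 < ij.2) && P ij.1 ij.2) +
   \sum_(ij : 'I_n * 'I_n) ((ij.1 < ij.2) && P ij.2 ij.1))%N.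
  rewrite -big_split /=; apply: eq_bigr => -[i j] _ /=.
  by case: ltnP; case: (P i j); case: (P j i).
rewrite [X in (_ + X)%N](reindex_inj (h := fun ij : 'I_n * 'I_n => (ij.2, ij.1))) /=;
  last by move=> [a b] [c e] /= [-> ->].
rewrite -big_split /=; apply: eq_bigr => -[i j] _ /=.
by rewrite -val_eqE /=; case: ltngtP; case: (P i j).
Qed.

(** Injectivity of [f] makes the rank a permutation of ['I_n]. A bound on each arc in terms of its
    rank can thus be summed over ranks. *)
Lemma sum_rank (R : realType) n (f : 'I_n -> R) (F : nat -> nat) :
  injective f ->
  (\sum_(j < n) F #|[set i | (f i < f j)%R]%SET| = \sum_(r < n) F r)%N.
Proof.
move=> f_inj.
have rk_lt j : (#|[set i | (f i < f j)%R]%SET| < n)%N.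
  rewrite -[ltnRHS]card_ord -cardsT; apply: proper_card.
  by apply/properP; split; [exact: finset.subsetT | exists j; rewrite ?inE ?ltxx].
pose rk j := Ordinal (rk_lt j).
have rk_mono i j : f i < f j -> (rk i < rk j)%N.
  move=> fij; apply: proper_card; apply/properP; split.
    by apply/fintype.subsetP => k; rewrite !inE => /lt_trans; apply.
  by exists i; rewrite !inE ?ltxx.
have rk_inj : injective rk.
  move=> i j eij; apply: f_inj.
  by case: (ltgtP (f i) (f j)) => // /rk_mono; rewrite eij ltnn.
by rewrite [RHS](reindex_inj rk_inj).
Qed.

(** * Clockwise distance and membership in arcs *)

Section Geometry.
Variable R : realType.
Implicit Types x y p q : circle R.

Definition cw q p : R := val p - val q + (val p < val q)%R%:R.

Lemma circle_bounds p : 0 <= val p /\ val p < 1.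
Proof. by case: p => p /= /andP[]. Qed.

Lemma cw_inj q : injective (cw q).
Proof.
move=> x y; rewrite /cw => e; apply: val_inj; move: e.
have := circle_bounds x; have := circle_bounds y.
move: (val x) (val y) (val q) => x' y' q' [? ?] [? ?].
by case: ltP => ?; case: ltP => ? /= ?; lra.
Qed.

Lemma cw_bounds q p : 0 <= cw q p /\ cw q p < 1.
Proof.
have := circle_bounds p; have := circle_bounds q; rewrite /cw.
move: (val p) (val q) => p' q' [? ?] [? ?].
by case: ltP => /= ?; lra.
Qed.

Lemma in_arcE x y p : in_arc x y p = (cw x p <= cw x y).
Proof.
have := circle_bounds x; have := circle_bounds y; have := circle_bounds p.
rewrite /in_arc /cw.
move: (val x) (val y) (val p) => x' y' p' [? ?] [? ?] [? ?].
apply/idP/idP; case: (lerP x' y') => ?; case: (ltP p' x') => ? /=;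
  try case/orP; try case/andP; move=> *; try lra.
all: by apply/orP; right; lra.
Qed.

Lemma in_arc_left x y : in_arc x y x.
Proof. by rewrite in_arcE {1}/cw ltxx addr0 subrr; have [] := cw_bounds x y. Qed.

(** If q is off the arc, then travelling clockwise from q one enters the arc at x before reaching
    p. *)
Lemma in_arc_cut q x y p : in_arc x y p -> in_arc x y q || in_arc q p x.
Proof.
rewrite !in_arcE /cw.
have := circle_bounds x; have := circle_bounds y.
have := circle_bounds p; have := circle_bounds q.
move: (val x) (val y) (val p) (val q) => x' y' p' q' [? ?] [? ?] [? ?] [? ?].
case: (ltP p' x') => ?; case: (ltP y' x') => ?; case: (ltP q' x') => ?;
  case: (ltP x' q') => ?; case: (ltP p' q') => ? /= h; apply/orP;
  first [ by exfalso; lra | by left; lra | by right; lra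
        | case: (leP q' y') => ?; first [by left; lra | by right; lra] ].
Qed.

End Geometry.

(** * Two upper bounds on the number of edges *)

Section EdgeBounds.
Variables (R : realType) (n : nat) (A : arcs R n).

Definition covers : rel 'I_n :=
  fun i j => in_arc (left_end A i) (right_end A i) (left_end A j).

Definition meet : rel 'I_n := fun i j => `[< arc_of A i `&` arc_of A j !=set0 >].

Lemma meetE i j : meet i j = covers i j || covers j i.
Proof.
apply/idP/idP => [/asboolP[p [/= ip jp]]|/orP[ij|ji]].
(* Cut arc i at the left end of j: either i contains that end, or the left end of i lies between it
   and the common point p, hence in arc j. *)
- case/orP: (in_arc_cut (left_end A j) ip) => [ij|h]; first by rewrite /covers ij.
  apply/orP; right; move: h jp; rewrite /covers !in_arcE => /le_trans h jp.
  by apply: h; rewrite -in_arcE.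
- by apply/asboolP; exists (left_end A j); split => //=; exact: in_arc_left.
- by apply/asboolP; exists (left_end A i); split => //=; exact: in_arc_left.
Qed.

Lemma meetC : symmetric meet.
Proof. by move=> i j; rewrite !meetE orbC. Qed.

Lemma card_covers j :
  #|[set i | (i != j) && covers i j]%SET| = (agreement A (left_end A j)).-1.
Proof.
rewrite /agreement [in RHS](cardsD1 j) inE in_arc_left /=.
by congr #|pred_of_set _|; apply/setP => i; rewrite !inE.
Qed.

Lemma edges_covers :
  (edges A + #|[set ij : 'I_n * 'I_n |
      (ij.1 < ij.2)%N && (covers ij.1 ij.2 && covers ij.2 ij.1)]%SET|
   = \sum_(j < n) (agreement A (left_end A j)).-1)%N.
Proof.
under [RHS]eq_bigr do rewrite -card_covers.
rewrite -card_sym_pairs; congr (_ + _)%N; apply: eq_card => -[i j].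
by rewrite !inE /= -meetE.
Qed.

Lemma max_agreementP p : (agreement A p <= max_agreement A)%N.
Proof.
rewrite /max_agreement; case: ex_maxnP => k _; apply.
by apply/asboolP; exists p.
Qed.

Lemma min_agreement_ex : exists p, agreement A p = min_agreement A.
Proof. by rewrite /min_agreement; case: ex_minnP => k /asboolP. Qed.

Lemma edges_le_ramp :
  (edges A <= \sum_(r < n) minn (max_agreement A).-1 (min_agreement A + r))%N.
Proof.
have [q qmin] := min_agreement_ex.
have key_inj : injective (fun j => cw q (left_end A j)).
  by move=> i j /cw_inj /left_end_inj.
rewrite -(sum_rank (fun r => minn _ (min_agreement A + r)) key_inj).
apply: (@leq_trans (\sum_(j < n) (agreement A (left_end A j)).-1)%N).
  by rewrite -edges_covers leq_addr.
apply: leq_sum => j _; rewrite leq_min -!subn1 leq_sub2r ?max_agreementP//=.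
(* An arc containing the left end of j passes through q, or is j itself, or starts strictly between
   q and that end: at most m + 1 + r arcs. *)
rewrite leq_subLR -qmin addnCA -[X in (_ + (X + _))%N](cards1 j).
apply: leq_trans (leq_add (leqnn _) (leq_card_setU _ _).1).
apply: leq_trans (leq_card_setU _ _).1.
apply/subset_leq_card/fintype.subsetP => i; rewrite !inE => /(in_arc_cut q).
case/orP=> [->//|]; rewrite in_arcE le_eqVlt orbC => /orP[->|].
  by rewrite !orbT.
by move=> /eqP/key_inj ->; rewrite eqxx orbT.
Qed.

(* The arcs through q come first, then the others by left end: an arc avoiding q
   meets, among its predecessors off q, only those containing its left end. *)
Lemma edges_le_trunc :
  (edges A <= \sum_(r < n) minn r (min_agreement A + (max_agreement A).-1))%N.
Proof.
have [q qmin] := min_agreement_ex.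
pose Q i := in_arc (left_end A i) (right_end A i) q.
(* Since [cw] takes values in [0, 1), subtracting 2 moves the arcs through q ahead of all others. *)
pose key j := cw q (left_end A j) - 2 * (Q j)%:R.
have key_inj : injective key.
  move=> i j; rewrite /key => e; apply: (@left_end_inj _ _ A); apply: (@cw_inj _ q).
  move: e; have := cw_bounds q (left_end A i); have := cw_bounds q (left_end A j).
  by case: (Q i); case: (Q j) => /= *; lra.
rewrite -(sum_rank (fun r => minn r _) key_inj).
(* Orienting each meeting pair by [key] lets [card_sym_pairs] bound the edges by the sum over j of
   the predecessors meeting j. *)
have -> : edges A = #|[set ij : 'I_n * 'I_n | (ij.1 < ij.2)%N &&
    ((key ij.1 < key ij.2) && meet ij.1 ij.2 ||
     (key ij.2 < key ij.1) && meet ij.2 ij.1)]%SET|.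
  apply: eq_card => -[i j]; rewrite !inE /= (meetC j i) -andb_orl -neq_lt.
  case: ltnP => //= ij; suff -> : key i != key j by [].
  by apply: contraTneq ij => /key_inj ->; rewrite ltnn.
pose P i j := (key i < key j) && meet i j.
apply: (@leq_trans (\sum_(j < n) #|[set i | (i != j) && P i j]%SET|)%N).
  by rewrite -card_sym_pairs leq_addr.
apply: leq_sum => j _; rewrite leq_min; apply/andP; split.
  by apply/subset_leq_card/fintype.subsetP => i; rewrite !inE => /and3P[].
apply: leq_trans
  (_ : #|[set i | Q i]%SET :|: [set i | (i != j) && covers i j]%SET|%SET <= _)%N.
  apply/subset_leq_card/fintype.subsetP => i; rewrite !inE => /and3P[-> ij /=].
  rewrite meetE; case: (covers i j) => /=; first by rewrite orbT.
  (* It remains that i avoids q and j contains the left end of i. Then j contains q or starts no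
     later than i clockwise from q, and either way j does not come after i. *)
  case Qi : (Q i) => //= ji; move: ij; rewrite /key Qi mulr0 subr0.
  case/orP: (in_arc_cut q ji); rewrite -/(Q j).
    move=> ->; have := cw_bounds q (left_end A i); have := cw_bounds q (left_end A j).
    by move=> /= [? ?] [? ?] *; suff: (0 : R) < 0 by [rewrite ltxx]; lra.
  rewrite in_arcE; case: (Q j).
    have := cw_bounds q (left_end A i); have := cw_bounds q (left_end A j).
    by move=> /= [? ?] [? ?] *; suff: (0 : R) < 0 by [rewrite ltxx]; lra.
  by rewrite mulr0 subr0 ltNge => ->.
apply: leq_trans (leq_card_setU _ _).1 _; apply: leq_add; first by rewrite -qmin.
by rewrite card_covers -!subn1 leq_sub2r ?max_agreementP.
Qed.

End EdgeBounds.

(** * The extremal collection *)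

Section Extremal.
Variable R : realType.

Lemma pt_subproof (t : nat) : 0 <= (1 - t.+1%:R^-1 : R) < 1.
Proof. by rewrite subr_ge0 invf_le1 ?ltr0n // ler1n /= gtrBl invr_gt0 ltr0n. Qed.

(** Only the cyclic order of the ends matters. This increasing sequence starts at the base point and
    offers room for arbitrarily many ends. *)
Definition pt (t : nat) : circle R := exist _ (1 - t.+1%:R^-1) (pt_subproof t).

Lemma pt_le s t : (val (pt s) <= val (pt t)) = (s <= t)%N.
Proof. by rewrite /= lerD2l lerN2 lef_pV2 ?posrE ?ltr0n // ler_nat. Qed.

Lemma pt_inj : injective pt.
Proof. by move=> s t e; apply/eqP; rewrite eqn_leq -!pt_le e lexx. Qed.

(** Sweep clockwise from the base point: start with the arcs that wrap around, add one at each left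
    end reached, remove one at each right end passed. *)
Lemma agreement_cut n (A : arcs R n) p :
  (agreement A p + \sum_(i < n) (val (right_end A i) < val p)%R
   = \sum_(i < n) (val (right_end A i) < val (left_end A i))%R
     + \sum_(i < n) (val (left_end A i) <= val p)%R)%N.
Proof.
rewrite /agreement -sum_nat_card -!big_split /=; apply: eq_bigr => i _.
rewrite /in_arc /=.
move: (sval (left_end A i)) (sval (right_end A i)) (sval p) => x' y' p'.
case: (leP x' y') => xy; case: (leP x' p') => xp; case: (leP p' y') => py //=.
  by move: (le_lt_trans xy (lt_trans py xp)); rewrite ltxx.
by move: (lt_le_trans xy (le_trans xp py)); rewrite ltxx.
Qed.

Variables n m d : nat.
Hypothesis dmn : (d + m.*2 < n)%N.

Definition shift (k : 'I_n) : 'I_n :=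
  Ordinal (ltn_pmod (k + m) (leq_ltn_trans (leq0n k) (ltn_ord k))).

Lemma shiftE k : shift k = (if k < n - m then k + m else k + m - n)%N :> nat.
Proof.
have kn := ltn_ord k; rewrite /=; case: ltnP => h; first by rewrite modn_small //; lia.
by rewrite -[in LHS](subnK (_ : n <= k + m)%N) ?modnDr ?modn_small; lia.
Qed.

Lemma shift_inj : injective shift.
Proof.
move=> i j e; have : shift i = shift j :> nat by rewrite e.
rewrite !shiftE => {}e; apply: ord_inj; move: e (ltn_ord i) (ltn_ord j).
by case: ltnP => ?; case: ltnP => ? *; lia.
Qed.

(** Positions are doubled to stay integral, so left ends are even and right ends odd. *)
Definition ext_left (k : 'I_n) := pt k.*2.
Definition ext_right (k : 'I_n) := pt (shift k + d).*2.+1.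

Lemma ext_left_inj : injective ext_left.
Proof. by move=> i j /pt_inj/double_inj; exact: ord_inj. Qed.

Lemma ext_right_inj : injective ext_right.
Proof.
move=> i j /pt_inj/succn_inj/double_inj/addIn e.
by apply: shift_inj; exact: ord_inj. Qed.

Lemma ext_left_right_neq i j : ext_left i <> ext_right j.
Proof. by move=> /pt_inj/(congr1 odd); rewrite /= !odd_double. Qed.

(* After the base point the left ends occur at 0, 2, 4, ... and the right ends at
   2d + 1, 2d + 3, ..., while the pairing by [shift] makes exactly the last m
   arcs wrap around: the agreement is m plus a quantity between 0 and d + 1. *)
Definition extremal : arcs R n :=
  Arcs ext_left_inj ext_right_inj ext_left_right_neq.

Lemma extremal_agreement p :
  (agreement extremal p + \sum_(k < n) (val (pt (k + d).*2.+1) < val p)%R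
   = m + \sum_(k < n) (val (pt k.*2) <= val p)%R)%N.
Proof.
rewrite [X in (_ + X)%N](reindex_inj shift_inj) (agreement_cut extremal).
congr (_ + _)%N.
(* Arc k wraps exactly when [shift] reduces k + m modulo n, because d + m < n. *)
transitivity (\sum_(k < n) (1 - (k < n - m)))%N.
  apply: eq_bigr => k _; rewrite ltNge.
  rewrite -[left_end _ k]/(pt _) -[right_end _ k]/(pt _) pt_le shiftE.
  by have := ltn_ord k; case: (ltnP k (n - m)) => /= *; lia.
rewrite sumnB; last by move=> k _; case: ltnP.
by rewrite sum_ltn_ord sum1_card card_ord; lia.
Qed.

(** The k-th right end comes after the k-th left end, so each right end passed is offset by a left
    end. *)
Lemma extremal_agreement_ge p : (m <= agreement extremal p)%N.
Proof.
rewrite -(leq_add2r (\sum_(k < n) (val (pt (k + d).*2.+1) < val p)%R)%N).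
rewrite extremal_agreement leq_add2l; apply: leq_sum => k _.
case: (ltP (val (pt (k + d).*2.+1)) (val p)) => // h.
by rewrite (le_trans _ (ltW h)) // pt_le; lia.
Qed.

(** The left end of index d + 1 + k comes after the right end of rank k, so at most d + 1 left ends
    are not offset. *)
Lemma extremal_agreement_le p : (agreement extremal p <= m + d.+1)%N.
Proof.
rewrite -(leq_add2r (\sum_(k < n) (val (pt (k + d).*2.+1) < val p)%R)%N).
rewrite extremal_agreement -addnA leq_add2l.
pose f k := (val (pt k.*2) <= val p : nat).
apply: (@leq_trans (\sum_(k < d.+1 + n) f k)%N).
  by rewrite addnC big_split_ord leq_addr.
rewrite big_split_ord /= leq_add //.
  by rewrite -[leqRHS]card_ord -sum1_card; apply: leq_sum => k _; exact: leq_b1.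
apply: leq_sum => k _; rewrite /f.
case: (leP (val (pt (d.+1 + k).*2)) (val p)) => // h.
by rewrite (lt_le_trans _ h) // ltNge pt_le; lia.
Qed.

Lemma extremal_agreement_left k :
  agreement extremal (left_end extremal k) = (m + minn k d).+1.
Proof.
have := extremal_agreement (left_end extremal k).
under eq_bigr => i _ do rewrite ltNge pt_le.
under [X in (_ = _ + X)%N]eq_bigr => i _ do rewrite pt_le.
have -> : (\sum_(i < n) ~~ (k.*2 <= (i + d).*2.+1) = k - d)%N.
  rewrite -[RHS](minn_idPl (_ : k - d <= n)%N); last by have := ltn_ord k; lia.
  by rewrite -sum_ltn_ord; apply: eq_bigr => i _; lia.
have -> : (\sum_(i < n) (i.*2 <= k.*2) = k.+1)%N.
  rewrite -[RHS](minn_idPl (_ : k.+1 <= n)%N) //.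
  by rewrite -sum_ltn_ord; apply: eq_bigr => i _; lia.
lia.
Qed.

Lemma extremal_min_agreement : min_agreement extremal = m.
Proof.
rewrite /min_agreement; case: ex_minnP => k /asboolP[p <-] kmin.
apply/eqP; rewrite eqn_leq extremal_agreement_ge andbT; apply: kmin.
(* This point lies beyond all the ends, where the n left ends and the n right ends cancel. *)
apply/asboolP; exists (pt (n + d).*2.+1).
have := extremal_agreement (pt (n + d).*2.+1).
rewrite [X in (_ + X)%N](eq_bigr (fun=> 1%N)); last first.
  by move=> i _; rewrite ltNge pt_le; have := ltn_ord i; lia.
rewrite [X in (_ = _ + X)%N](eq_bigr (fun=> 1%N)); last first.
  by move=> i _; rewrite pt_le; have := ltn_ord i; lia.
by move/addIn.
Qed.

Lemma extremal_max_agreement : (max_agreement extremal <= m + d.+1)%N.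
Proof.
rewrite /max_agreement; case: ex_maxnP => k /asboolP[p <-] _.
exact: extremal_agreement_le.
Qed.

(** For i < j, arc j can contain the left end of i only by wrapping, which leaves m values of j. For
    each of them, i >= j - (m + d) because i reaches the left end of j, and i <= j + m + d - n
    because j reaches that of i. *)
Lemma extremal_double_pairs :
  (#|[set ij : 'I_n * 'I_n | (ij.1 < ij.2)%N &&
       (covers extremal ij.1 ij.2 && covers extremal ij.2 ij.1)]%SET|
   <= m * (((m + d).*2).+1 - n))%N.
Proof.
rewrite -sum_nat_card -(pair_big xpredT xpredT (fun i j : 'I_n =>
  (i < j)%N && (covers extremal i j && covers extremal j i) : nat)) /=.
rewrite exchange_big /=.
apply: (@leq_trans (\sum_(j < n) (1 - (j < n - m)) * ((m + d).*2.+1 - n))%N).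
  apply: leq_sum => j _.
  apply: (@leq_trans (\sum_(i < n) (j - (m + d) <= i < j + (m + d).+1 - n) *
                       (n - m <= j))%N).
    apply: leq_sum => i _; rewrite /covers /in_arc.
    rewrite -![left_end _ _]/(pt _) -![right_end _ _]/(pt _) !pt_le.
    have := shiftE i; have := shiftE j; have := ltn_ord i; have := ltn_ord j.
    move: (shift i : nat) (shift j : nat) => si sj.
    case: (leqP (n - m) j) => ?; rewrite ?muln0 ?muln1.
      by do !case: ifP => ?; lia.
    by do !case: ifP => ?; lia.
  rewrite -big_distrl /= mulnC; case: (leqP (n - m) j) => /= h; last by rewrite mul0n.
  by rewrite mul1n subn0 mul1n (leq_trans (sum_itv_ord _ _ _)) //; lia.
rewrite -big_distrl /= leq_mul2r; apply/orP; right.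
rewrite sumnB; last by move=> k _; case: ltnP.
by rewrite sum_ltn_ord sum1_card card_ord; lia.
Qed.

Lemma extremal_edges :
  (\sum_(k < n) (m + minn k d) <= edges extremal + m * (((m + d).*2).+1 - n))%N.
Proof.
rewrite [leqLHS](eq_bigr (fun k => (agreement extremal (left_end extremal k)).-1)).
  by rewrite -edges_covers leq_add2l extremal_double_pairs.
by move=> k _; rewrite extremal_agreement_left.
Qed.

End Extremal.

(** * Bounds on [e_min] *)

Section EdgeThreshold.
Variable R : realType.

Lemma e_min_gt n (A : arcs R n) M :
  (max_agreement A < M)%N -> (edges A < e_min R M (min_agreement A) n)%N.
Proof.
move=> AM; rewrite /e_min; case: ex_minnP => k /asboolP g _.
by rewrite ltnNge; apply: contraL AM => /(g A erefl); rewrite -leqNgt.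
Qed.

Lemma e_min_le M m n B :
  (forall A : arcs R n, min_agreement A = m -> (max_agreement A < M)%N ->
     (edges A <= B)%N) ->
  (e_min R M m n <= B.+1)%N.
Proof.
move=> hB; rewrite /e_min; case: ex_minnP => k _; apply; apply/asboolP => A Am.
by rewrite ltnNge [in X in _ -> X]leqNgt; apply: contra => /(hB A Am).
Qed.

Lemma e_min_le_ramp M m n :
  (e_min R M m n <= (\sum_(r < n) minn (M - 2) (m + r)).+1)%N.
Proof.
apply: e_min_le => A <- AM; apply: leq_trans (edges_le_ramp A) _.
by apply: leq_sum => r _; lia.
Qed.

Lemma e_min_le_trunc M m n :
  (e_min R M m n <= (\sum_(r < n) minn r (m + (M - 2))).+1)%N.
Proof.
apply: e_min_le => A <- AM; apply: leq_trans (edges_le_trunc A) _.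
by apply: leq_sum => r _; lia.
Qed.

Lemma e_min_ge M m n : (m + 2 <= M)%N -> (M + m <= n + 1)%N ->
  (\sum_(r < n) (m + minn r (M - 2 - m))
   <= e_min R M m n + m * ((M - 2).*2.+1 - n))%N.
Proof.
(* The choice d = M - 2 - m makes the largest possible agreement m + d + 1 equal to M - 1. *)
move=> mM Mmn; have dmn : (M - 2 - m + m.*2 < n)%N by lia.
have := extremal_edges R dmn; rewrite subnKC; last by lia.
move=> /leq_trans; apply; rewrite leq_add2r.
have /e_min_gt : (max_agreement (extremal R dmn) < M)%N.
  by have := extremal_max_agreement R dmn; lia.
by rewrite extremal_min_agreement; exact: ltnW.
Qed.

Lemma sum_minn n c : (c <= n)%N ->
  (2 * \sum_(r < n) minn r c + c * c.+1 = 2 * n * c)%N.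
Proof.
move=> /subnKC <-; elim: (n - c)%N => [|t IHt]; last first.
  rewrite addnS big_ord_recr /= (minn_idPr (leq_addr t c)).
  by move: IHt; move: (\sum_(_ < _) _)%N => S IHt; nia.
rewrite addn0 (eq_bigr val) => [|r _]; last by rewrite /=; have := ltn_ord r; lia.
elim: c => [|c IHc]; first by rewrite big_ord0.
rewrite big_ord_recr /=; move: IHc; move: (\sum_(_ < _) _)%N => S IHc; nia.
Qed.

End EdgeThreshold.

Section ThresholdBounds.
Variables (R : realType) (n M m : nat).
Local Notation e := ((e_min R M m n)%:R : R).
Local Notation z := (n%:R : R).
Local Notation x := (M%:R : R).
Local Notation y := (m%:R : R).

(** This crude bound serves the case beta = 0, where m + 2 <= M may fail. *)
Lemma e_min_le_trivial : e <= z * x + 1.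
Proof.
rewrite -natrM natr1 ler_nat; apply: leq_trans (e_min_le_ramp R M m n) _.
rewrite ltnS -[X in (_ <= X * _)%N]card_ord -sum_nat_const.
by apply: leq_sum => r _; lia.
Qed.

Hypothesis mM : (m + 2 <= M)%N.
Hypothesis Mmn : (M + m <= n + 1)%N.

Let M2E : (M - 2)%:R = x - 2 :> R.
Proof. by rewrite natrB //; lia. Qed.

Let sum_minnE c : (c <= n)%N ->
  2 * (\sum_(r < n) minn r c)%N%:R = 2 * z * c%:R - c%:R * (c%:R + 1) :> R.
Proof.
move=> /sum_minn /(congr1 (fun k => k%:R : R)) /eqP.
by rewrite natrD !natrM -natr1 -subr_eq0 => /eqP ?; lra.
Qed.

Let rampE : 2 * (\sum_(r < n) (m + minn r (M - 2 - m)))%N%:R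
   = 2 * z * (x - 2) - (x - y - 2) * (x - y - 1) :> R.
Proof.
rewrite big_split /= sum_nat_const card_ord natrD natrM mulrDr sum_minnE; last lia.
by rewrite natrB ?M2E; [ring | lia].
Qed.

Lemma e_min_le1 : 2 * e <= 2 * z * (x - 2) - (x - y - 2) * (x - y - 1) + 2.
Proof.
rewrite -rampE -[X in _ + X]mulr1 -mulrDr ler_pM2l // natr1 ler_nat.
apply: leq_trans (e_min_le_ramp R M m n) _.
by rewrite ltnS; apply: leq_sum => r _; lia.
Qed.

Lemma e_min_le2 : 2 * e <= (x + y - 2) * (2 * z - (x + y - 1)) + 2.
Proof.
have -> : (x + y - 2) * (2 * z - (x + y - 1)) =
    2 * (\sum_(r < n) minn r (m + (M - 2)))%N%:R :> R.
  by rewrite sum_minnE ?natrD ?M2E; [ring | lia].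
rewrite -[X in _ + X]mulr1 -mulrDr ler_pM2l // natr1 ler_nat.
exact: e_min_le_trunc.
Qed.

(** With t = 2M - 3 - n, the sum of t and its absolute value is twice the truncated difference of
    [e_min_ge], in a form continuous in t. *)
Lemma e_min_ge1 : 2 * z * (x - 2) - (x - y - 2) * (x - y - 1)
  - y * (2 * x - 3 - z + `|2 * x - 3 - z|) <= 2 * e.
Proof.
rewrite lerBlDr -rampE.
have /(leq_mul (leqnn 2)) := e_min_ge R mM Mmn.
rewrite -(ler_nat R) natrM => /le_trans; apply.
rewrite natrM natrD mulrDr lerD2l natrM mulrCA ler_wpM2l //.
have [h|h] := leqP (M - 2).*2.+1 n.
  rewrite (eqP h) mulr0; have := ler_norm (- (2 * x - 3 - z)).
  by rewrite normrN; lra.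
have -> : ((M - 2).*2.+1 - n)%:R = 2 * x - 3 - z :> R.
  by rewrite natrB ?(ltnW h)// -natr1 -mul2n natrM M2E; lra.
by have := ler_norm (2 * x - 3 - z); lra.
Qed.

End ThresholdBounds.

(** * Normalization and passage to the limit *)

(** The binomial coefficient is n^2 (1 - u) / 2 and c is m / n, so these are the previous bounds on
    twice [e_min], multiplied by u^2 / (1 - u). *)
Lemma alpha_bounds (R : realType) (n M m : nat) (a b g : R) (u := n%:R^-1 : R)
    (c := g * b) : (1 < n)%N ->
  (e_min R M m n)%:R = a * 'C(n, 2)%:R -> M%:R = b * n%:R -> m%:R = g * M%:R ->
  [/\ 0 <= a, a <= (2 * b + 2 * u ^+ 2) / (1 - u) &
  (m + 2 <= M)%N -> (M + m <= n + 1)%N ->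
  [/\ a <= (2 * (b - 2 * u) - (b - c - 2 * u) * (b - c - u) + 2 * u ^+ 2) / (1 - u),
      a <= ((b + c - 2 * u) * (2 - (b + c - u)) + 2 * u ^+ 2) / (1 - u) &
      (2 * (b - 2 * u) - (b - c - 2 * u) * (b - c - u)
       - c * (2 * b - 3 * u - 1 + `|2 * b - 3 * u - 1|)) / (1 - u) <= a]].
Proof.
move=> n1 ea eb eg.
have z0 : 0 < n%:R :> R by rewrite ltr0n; lia.
have zN0 : n%:R != 0 :> R by rewrite gt_eqF.
have u1 : 0 < 1 - u by rewrite subr_gt0 invf_lt1 // ltr1n.
have z1 : n%:R - 1 != 0 :> R by rewrite subr_eq0 pnatr_eq1; lia.
have bin : 'C(n, 2)%:R = n%:R * (n%:R - 1) / 2 :> R.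
  have := mul_bin_diag n 1; rewrite bin1 => /(congr1 (fun k => k%:R : R)).
  by rewrite !natrM -subn1 natrB ?(ltnW n1)//; lra.
have xE : b = M%:R * u by rewrite eb mulfK.
have yE : c = m%:R * u by rewrite /c eg eb mulrA mulfK.
have zu : n%:R * u = 1 by rewrite mulfV.
have aE : a = 2 * (e_min R M m n)%:R * u ^+ 2 / (1 - u).
  rewrite ea bin /u; field.
  by rewrite zN0 z1.
have key v w : 2 * (e_min R M m n)%:R <= v -> v * u ^+ 2 = w -> a <= w / (1 - u).
  move=> hv <-; rewrite aE ler_pM2r ?invr_gt0 // ler_wpM2r //.
  by rewrite exprn_ge0 // invr_ge0 ltW.
split.
- by rewrite aE !mulr_ge0 ?invr_ge0 ?(ltW u1) // exprn_ge0 // invr_ge0 ltW.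
- apply: key (_ : _ <= 2 * (n%:R * M%:R + 1)) _.
    by rewrite ler_pM2l // e_min_le_trivial.
  by rewrite xE /u; field.
move=> mM Mmn; split.
- by apply: key (e_min_le1 R mM Mmn) _; rewrite xE yE /u; field.
- by apply: key (e_min_le2 R mM Mmn) _; rewrite xE yE /u; field.
- rewrite aE ler_pM2r ?invr_gt0 //.
  have nE : `|2 * b - 3 * u - 1| = `|2 * M%:R - 3 - n%:R| * u.
    rewrite -[X in _ = _ * X](@ger0_norm _ u) ?invr_ge0 ?(ltW z0)// -normrM.
    by congr `|_|; rewrite xE /u; field.
  have := ler_wpM2r (_ : 0 <= u ^+ 2) (e_min_ge1 R mM Mmn).
  rewrite exprn_ge0 ?invr_ge0 ?(ltW z0)// => /(_ isT); apply: le_trans.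
  rewrite nE xE yE; move: `|_| => t.
  by rewrite le_eqVlt; apply/orP; left; apply/eqP; rewrite /u; field.
Qed.

Ltac cvg_expr :=
  repeat first [ eassumption | exact: cvg_cst | apply: cvgB | apply: cvgD
               | apply: cvgM | apply: cvg_norm ].

Theorem theorem18 (R : realType) (n M m : nat -> nat)
    (alpha_ beta_ gamma_ : nat -> R) (beta gamma : R)
    (hn : n @ \oo --> \oo)
    (hMmn : \forall k \near \oo, (M k + m k <= n k + 1)%N)
    (halpha : \forall k \near \oo,
       (e_min R (M k) (m k) (n k))%:R = alpha_ k * 'C(n k, 2)%:R)
    (hbeta : \forall k \near \oo, (M k)%:R = beta_ k * (n k)%:R)
    (hgamma : \forall k \near \oo, (m k)%:R = gamma_ k * (M k)%:R)
    (hbeta_lim : beta_ @ \oo --> beta)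
    (hgamma_lim : gamma_ @ \oo --> gamma)
    (hgamma01 : 0 <= gamma <= 1)
    (* the degenerate case M <= m + 1, where e_min = 0, is excluded only when
       gamma = 1, where the limits of beta_ and gamma_ do not already rule it out *)
    (hgamma1 : 0 < beta -> gamma = 1 -> \forall k \near \oo, (m k + 1 < M k)%N) :
  (0 <= beta <= 1 / 2 ->
     alpha_ @ \oo --> beta * (2 - (1 - gamma) ^+ 2 * beta)) /\
  (1 / 2 < beta <= 1 / (1 + gamma) ->
     alpha_ @ \oo --> beta * (gamma + 1) * (2 - beta * (gamma + 1))).
Proof.
have n2 : \forall k \near \oo, (1 < n k)%N by exact: (hn _ (nbhs_infty_gt 1)).
pose u k := (n k)%:R^-1 : R; pose c k := gamma_ k * beta_ k.
have u_lim : u @ \oo --> (0 : R).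
  suff : (fun j => j%:R^-1 : R) @ \oo --> (0 : R) by exact: cvg_comp.
  apply/gtr0_cvgV0.
    by near=> j; rewrite ltr0n; near: j; exists 1%N.
  exact: cvgr_idn.
have c_lim : c @ \oo --> gamma * beta by exact: cvgM.
have d_lim : (fun k => (1 - u k)^-1) @ \oo --> (1 : R).
  have : (fun k => 1 - u k) @ \oo --> (1 - 0 : R) by exact: cvgB (cvg_cst _) u_lim.
  by rewrite subr0 => /cvgV; rewrite invr1; apply; exact: oner_neq0.
pose f0 k := (2 * beta_ k + 2 * (u k * u k)) / (1 - u k).
pose f1 k := (2 * (beta_ k - 2 * u k) -
  (beta_ k - c k - 2 * u k) * (beta_ k - c k - u k) + 2 * (u k * u k)) / (1 - u k).
pose f2 k := ((beta_ k + c k - 2 * u k) * (2 - (beta_ k + c k - u k)) +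
  2 * (u k * u k)) / (1 - u k).
pose h k := 2 * beta_ k - 3 * u k - 1.
pose f3 k := (2 * (beta_ k - 2 * u k) - (beta_ k - c k - 2 * u k) * (beta_ k - c k - u k)
       - c k * (h k + `|h k|)) / (1 - u k).
(* The limits are left unsimplified, with 0 in place of [u], so that [cvg_expr] can follow their
   syntax. *)
have f0_lim : f0 @ \oo --> (2 * beta + 2 * (0 * 0)) * 1 by cvg_expr.
have f1_lim : f1 @ \oo --> (2 * (beta - 2 * 0) - (beta - gamma * beta - 2 * 0) *
   (beta - gamma * beta - 0) + 2 * (0 * 0)) * 1 by cvg_expr.
have f2_lim : f2 @ \oo --> ((beta + gamma * beta - 2 * 0) *
   (2 - (beta + gamma * beta - 0)) + 2 * (0 * 0)) * 1 by cvg_expr.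
have h_lim : h @ \oo --> (2 * beta - 3 * 0 - 1) by cvg_expr.
have f3_lim : f3 @ \oo --> (2 * (beta - 2 * 0) - (beta - gamma * beta - 2 * 0) *
   (beta - gamma * beta - 0) -
   gamma * beta * ((2 * beta - 3 * 0 - 1) + `|2 * beta - 3 * 0 - 1|)) * 1 by cvg_expr.
have alpha_le0 : \forall k \near \oo, 0 <= alpha_ k <= f0 k.
  near=> k.
  have [||||p q _] :=
    @alpha_bounds R (n k) (M k) (m k) (alpha_ k) (beta_ k) (gamma_ k).
  - by near: k.
  - by near: k.
  - by near: k.
  - by near: k.
  - by rewrite p /f0 -expr2.
(* If gamma < 1, then (M - m - 2) / n tends to (1 - gamma) beta > 0. *)
have gap : 0 < beta -> \forall k \near \oo, (m k + 2 <= M k)%N.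
  move=> beta0; have [gamma1|gammaN1] := eqVneq gamma 1.
    by move: (hgamma1 beta0 gamma1); apply: filterS => k; rewrite addn1 addn2.
  have gap_lim : (fun k => beta_ k - c k - 2 * u k) @ \oo --> beta - gamma * beta - 2 * 0.
    by cvg_expr.
  have gap0 : 0 < beta - gamma * beta - 2 * 0.
    rewrite mulr0 subr0 -[X in X - _]mul1r -mulrBl mulr_gt0 // subr_gt0.
    by rewrite lt_neqAle gammaN1; case/andP: hgamma01.
  near=> k.
  have : 0 < beta_ k - c k - 2 * u k by near: k; exact: (cvgr_gt _ gap_lim).
  have nk : (1 < n k)%N by near: k.
  have nk0 : 0 < (n k)%:R :> R by rewrite ltr0n; lia.
  rewrite -(pmulr_lgt0 _ nk0) !mulrBl /c -!mulrA mulVf ?gt_eqF // mulr1.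
  have <- : (M k)%:R = beta_ k * (n k)%:R by near: k.
  have <- : (m k)%:R = gamma_ k * (M k)%:R by near: k.
  by rewrite -(ler_nat R) natrD; lra.
have alpha_bnd : 0 < beta -> \forall k \near \oo,
    [/\ alpha_ k <= f1 k, alpha_ k <= f2 k & f3 k <= alpha_ k].
  move=> /gap gapk; near=> k.
  have [||||_ _] := @alpha_bounds R (n k) (M k) (m k) (alpha_ k) (beta_ k) (gamma_ k).
  - by near: k.
  - by near: k.
  - by near: k.
  - by near: k.
  rewrite /f1 /f2 /f3 -!expr2; apply; first by near: k.
  by near: k.
split=> /andP[hb1 hb2].
- have [beta0|betaN0] := eqVneq beta 0.
    rewrite beta0 mul0r; apply: (squeeze_cvgr alpha_le0); first exact: cvg_cst.
    by move: f0_lim; rewrite beta0 !mulr0 addr0 mul0r.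
  have beta0 : 0 < beta by rewrite lt_neqAle eq_sym betaN0.
  (* As 2 beta - 1 <= 0, the correction in [f3] vanishes in the limit, where [f3] and [f1] agree. *)
  apply: (@squeeze_cvgr _ _ _ _ f3 f1).
  + by move: (alpha_bnd beta0); apply: filterS => k [-> _ ->].
  + move: f3_lim; rewrite ler0_norm; last by lra.
    by congr (_ --> _); ring.
  + by move: f1_lim; congr (_ --> _); ring.
- have beta0 : 0 < beta by lra.
  (* Here the correction tends to 2 gamma beta (2 beta - 1), exactly the difference between the
     limits of [f1] and [f2]. *)
  apply: (@squeeze_cvgr _ _ _ _ f3 f2).
  + by move: (alpha_bnd beta0); apply: filterS => k [_ -> ->].
  + move: f3_lim; rewrite ger0_norm; last by lra.
    by congr (_ --> _); ring.
  + by move: f2_lim; congr (_ --> _); ring.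
Unshelve. all: by end_near.
Qed.
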